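(* Let $L$ be a finite trim lattice, let $\hat0=x_0\lessdot x_1\lessdot\cdots\lessdot x_n=\hat1$ be a maximal chain of left modular elements where $L$ has exactly $n$ join-irreducibles and $n$ meet-irreducibles, and for a join-irreducible $v$ let $\delta(v)=\min\{i: v\le x_i\}$. If $a,b_1,\dots,b_k$ are atoms of $L$ with $\delta(a)<\delta(b_1)<\cdots<\delta(b_k)$, then $a\not< b_1\vee\cdots\vee b_k$.
   Context: An element $x$ of a lattice $L$ is left modular if for all $y<z$ in $L$, $(y\vee x)\wedge z=y\vee(x\wedge z)$. A join-irreducible is an element other than $\hat0$ that is not the join of two strictly smaller elements; a meet-irreducible is an element other than $\hat1$ that is not the meet of two strictly larger elements. A lattice is trim if, for some $n$, it has a maximal chain of $n+1$ left modular elements and exactly $n$ join-irreducibles and exactly $n$ meet-irreducibles. Atoms (elements covering $\hat0$) are join-irreducible. *)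

(* Defs.v *)
From mathcomp Require Import all_boot all_order.

Set Implicit Arguments.
Unset Strict Implicit.
Unset Printing Implicit Defensive.

Import Order.TTheory.
Local Open Scope order_scope.

Definition covers (d : Order.disp_t) (L : finPOrderType d) (x y : L) : bool :=
  (x < y) && [forall z, ~~ ((x < z) && (z < y))].

Definition atom (d : Order.disp_t) (L : finTBLatticeType d) (a : L) : bool :=
  covers \bot a.

Definition left_modular (d : Order.disp_t) (L : finTBLatticeType d) (x : L) :
    bool :=
  [forall y : L, forall z : L,
    (y < z) ==> ((y `|` x) `&` z == y `|` (x `&` z))].

Definition join_irreducible (d : Order.disp_t) (L : finTBLatticeType d)
    (x : L) : bool :=
  (x != \bot) &&
  ~~ [exists y : L, exists z : L, [&& y < x, z < x & x == y `|` z]].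

Definition meet_irreducible (d : Order.disp_t) (L : finTBLatticeType d)
    (x : L) : bool :=
  (x != \top) &&
  ~~ [exists y : L, exists z : L, [&& x < y, x < z & x == y `&` z]].

(* x_0, ..., x_n is saturated from \bot to \top, hence maximal among chains. *)
Definition maximal_chain (d : Order.disp_t) (L : finTBLatticeType d) (n : nat)
    (x : 'I_n.+1 -> L) : Prop :=
  [/\ x ord0 = \bot, x ord_max = \top &
      forall i j : 'I_n.+1, j = i.+1 :> nat -> covers (x i) (x j)].

Definition trim_chain (d : Order.disp_t) (L : finTBLatticeType d) (n : nat)
    (x : 'I_n.+1 -> L) : Prop :=
  [/\ maximal_chain x,
      forall i, left_modular (x i),
      #|[set v : L | join_irreducible v]| = n &
      #|[set v : L | meet_irreducible v]| = n].

Definition trim (d : Order.disp_t) (L : finTBLatticeType d) : Prop :=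
  exists (n : nat) (x : 'I_n.+1 -> L), trim_chain x.

(* The default index ord_max satisfies the condition as soon as
   x ord_max = \top, so on a maximal chain this is the true minimum. *)
Definition delta (d : Order.disp_t) (L : finTBLatticeType d) (n : nat)
    (x : 'I_n.+1 -> L) (v : L) : 'I_n.+1 :=
  [arg min_(i < ord_max | (v <= x i)%O) (i : nat)]%N.

(* Main.v *)
Require Import Defs.
From mathcomp Require Import all_boot all_order.

(* Write B for the join of the b_i, and suppose a <= B.  Let r be minimal with
   c := x_r /\ B different from 0, so that r <= delta a < delta b_i and
   therefore c is not below the atom b_i.  Left modularity of x_(r-1) gives
   (b_i \/ x_(r-1)) /\ B = b_i \/ (x_(r-1) /\ B) = b_i, so c is not below
   b_i \/ x_(r-1), and some meet-irreducible lies above b_i \/ x_(r-1) but not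
   above c.  As there are as many meet-irreducibles as steps in the chain, only
   one of them is above x_(r-1) and not above x_r; hence it is the same one for
   all i.  It is then above B >= c, a contradiction. *)

Import Order.TTheory.
Local Open Scope order_scope.

(** Take [m] maximal among the elements above [w] and not above [c]. Everything strictly above [m]
    is then above [c], so a meet of two such elements is above [c] too and cannot be [m]. *)
Lemma meet_irreducible_separation (d : Order.disp_t) (L : finTBLatticeType d)
    (w c : L) :
  ~~ (c <= w) -> exists m : L, [/\ meet_irreducible m, w <= m & ~~ (c <= m)].
Proof.
move=> ncw; pose P (t : L) := (w <= t) && ~~ (c <= t).
have Pw : P w by rewrite /P lexx.
(* Maximality is obtained by maximizing the size of the down-set, which strictly increases with the
   element. *)
case: (@arg_maxnP _ w P (fun t => #|[set s : L | s <= t]|) Pw) => m /andP[wm ncm] mmax.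
have above t : m < t -> c <= t.
  move=> mt; apply: contraT => nct.
  have /mmax /= : P t by rewrite /P nct (le_trans wm (ltW mt)).
  rewrite leqNgt (proper_card _) //; apply/properP; split.
    by apply/subsetP => s; rewrite !inE => /le_trans; apply; apply: ltW.
  by exists t; rewrite !inE ?lexx // lt_geF.
exists m; split=> //; apply/andP; split.
  by apply: contraNneq ncm => ->; rewrite lex1.
apply/existsP => -[y /existsP[z /and3P[my mz /eqP mE]]].
by case/negP: ncm; rewrite mE lexI !above.
Qed.

Lemma maximal_chain_le (d : Order.disp_t) (L : finTBLatticeType d) (n : nat)
    (x : 'I_n.+1 -> L) (i j : 'I_n.+1) :
  maximal_chain x -> (i <= j)%N -> x i <= x j.
Proof.
case=> _ _ xcov; case: j => j; elim: j => [|j IHj] jn /= ij.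
  by rewrite (_ : i = Ordinal jn) //; apply/val_inj/eqP; rewrite /= -leqn0.
move: ij; rewrite leq_eqVlt => /orP[/eqP ij|ij].
  by rewrite (_ : i = Ordinal jn) //; apply: val_inj.
apply: (le_trans (IHj (ltnW jn) ij)); apply: ltW.
by have /andP[] := xcov (Ordinal (ltnW jn)) (Ordinal jn) erefl.
Qed.

(** Separation gives each of the [n] steps a meet-irreducible, and no element can serve two steps.
    The resulting injection into at most [n] meet-irreducibles is onto, so no step has a second
    one. *)
Lemma meet_irreducible_step_unique (d : Order.disp_t) (L : finTBLatticeType d)
    (n : nat) (x : 'I_n.+1 -> L) (i j : 'I_n.+1) (m m' : L) :
  maximal_chain x -> (#|[set v : L | meet_irreducible v]| <= n)%N ->
  j = i.+1 :> nat ->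
  meet_irreducible m -> x i <= m -> ~~ (x j <= m) ->
  meet_irreducible m' -> x i <= m' -> ~~ (x j <= m') -> m = m'.
Proof.
move=> xmax cardM ji.
pose lo (k : 'I_n) := widen_ord (leqnSn n) k.
pose step (k : 'I_n) (v : L) :=
  [&& meet_irreducible v, x (lo k) <= v & ~~ (x (lift ord0 k) <= v)].
have step_ex k : exists v, step k v.
  have [|v [vm kv nkv]] := @meet_irreducible_separation _ _ (x (lo k)) (x (lift ord0 k)).
    have [_ _ xcov] := xmax.
    by have /andP[xlt _] := xcov (lo k) (lift ord0 k) (lift0 k); rewrite lt_geF.
  by exists v; apply/and3P.
pose f k := xchoose (step_ex k).
have fP k : step k (f k) by apply: xchooseP.
have step_le k l v : step k v -> step l v -> (l <= k)%N.
  (* If [k < l], the upper end of step [k] is below the lower end of step [l], hence below [v]. *)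
  move=> /and3P[_ _ nkv] /and3P[_ lv _]; rewrite leqNgt; apply: contra nkv => kl.
  by apply: le_trans lv; apply: maximal_chain_le; rewrite ?lift0.
have step_inj k l v : step k v -> step l v -> k = l.
  by move=> kv lv; apply/val_inj/eqP; rewrite eqn_leq (step_le l k v) ?(step_le k l v).
have f_inj : injective f.
  by move=> k l fkl; apply: (step_inj k l (f k)) => //; rewrite fkl.
have fM : f @: [set: 'I_n] = [set v | meet_irreducible v].
  apply/eqP; rewrite eqEcard card_imset // cardsT card_ord cardM andbT.
  by apply/subsetP => _ /imsetP[k _ ->]; rewrite inE; case/and3P: (fP k).
have im : (i < n)%N by rewrite -ltnS -ji.
have iE : i = lo (Ordinal im) by apply: val_inj.
have jE : j = lift ord0 (Ordinal im) by apply: ord_inj; rewrite lift0.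
have eq_f v : meet_irreducible v -> x i <= v -> ~~ (x j <= v) -> v = f (Ordinal im).
  move=> vm iv njv; have : v \in f @: [set: 'I_n] by rewrite fM inE.
  case/imsetP=> k _ vE; rewrite vE; congr f; apply: (step_inj _ _ v).
    by rewrite vE.
  by rewrite /step vm -iE iv -jE.
by move=> *; rewrite [m]eq_f // [m']eq_f.
Qed.

Lemma le_chain_delta (d : Order.disp_t) (L : finTBLatticeType d) (n : nat)
    (x : 'I_n.+1 -> L) (v : L) :
  x ord_max = \top -> v <= x (delta x v).
Proof. by move=> xT; rewrite /delta; case: arg_minnP; rewrite ?xT ?lex1. Qed.

Lemma delta_le (d : Order.disp_t) (L : finTBLatticeType d) (n : nat)
    (x : 'I_n.+1 -> L) (v : L) (i : 'I_n.+1) :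
  x ord_max = \top -> v <= x i -> (delta x v <= i)%N.
Proof.
move=> xT vi; rewrite /delta; case: arg_minnP => [|j _ jmin]; first by rewrite xT lex1.
exact: jmin.
Qed.

Theorem theorem5 (d : Order.disp_t) (L : finTBLatticeType d)
    (L_trim : trim L)
    (n : nat) (x : 'I_n.+1 -> L) (x_trim : trim_chain x)
    (k : nat) (a : L) (b : 'I_k.+1 -> L)
    (a_atom : atom a) (b_atom : forall i, atom (b i))
    (delta_ab : (delta x a < delta x (b ord0))%N)
    (delta_b : forall i j : 'I_k.+1, (i < j)%N ->
       (delta x (b i) < delta x (b j))%N) :
  ~ (a < \join_(i < k.+1) b i).
Proof.
set B := \join_(i < k.+1) b i => /ltW aB.
have [xmax xlm _ cardM] := x_trim; have [x0 xT _] := xmax.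
have bB i : b i <= B by apply: joins_sup.
have ab i : (delta x a < delta x (b i))%N.
  have [->//|i0] := eqVneq i ord0.
  by apply: (ltn_trans delta_ab); apply: delta_b; rewrite lt0n.
have a0 : a != \bot by case/andP: a_atom; rewrite lt0x.
have aP : x (delta x a) `&` B != \bot.
  by rewrite -lt0x (@lt_le_trans _ _ a) ?lt0x // lexI aB le_chain_delta.
case: (@arg_minnP _ (delta x a) (fun i => x i `&` B != \bot) val aP) => r c0 rmin.
have ra := rmin _ aP; pose c := x r `&` B.
have ncb i : ~~ (c <= b i).
  (* As [b i] is an atom and [c] is nonzero, [c <= b i] forces [c = b i], hence [b i <= x r]. *)
  apply/negP => cb; have /andP[_ /forallP/(_ c)] := b_atom i.
  rewrite lt0x c0 /= lt_neqAle cb andbT negbK => /eqP cE.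
  have : (delta x (b i) <= r)%N by apply: delta_le => //; rewrite -cE leIl.
  by rewrite leqNgt (leq_ltn_trans ra (ab i)).
have [r0|r0] := posnP r.
  by move: c0; rewrite (_ : r = ord0) ?x0 ?meet0x ?eqxx //; apply: val_inj.
have sn : (r.-1 < n.+1)%N by apply: leq_ltn_trans (leq_pred r) (ltn_ord r).
pose s := Ordinal sn; have rs : r = s.+1 :> nat by rewrite /= prednK.
have sB : x s `&` B = \bot.
  by apply/eqP; apply: contraTT isT => /rmin /=; rewrite rs /= ltnn.
have sep i : exists m, [/\ meet_irreducible m, b i `|` x s <= m & ~~ (c <= m)].
  apply: meet_irreducible_separation; apply: contra (ncb i) => cbs.
  (* Left modularity speaks only of [y < z]; equality [b i = B] would put [c] below [b i]. *)
  have bltB : b i < B.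
    rewrite lt_neqAle bB andbT; apply: contraNneq (ncb i) => ->.
    exact: leIr.
  have := xlm s; move=> /forallP/(_ (b i))/forallP/(_ B)/implyP/(_ bltB)/eqP.
  by rewrite sB joinx0 => <-; rewrite lexI cbs leIr.
have [m [mM m0 ncm]] := sep ord0.
(* Since [c <= x r], failing to be above [c] places [v] at the step from [x s] to [x r] once
   [x s <= v]. *)
have nr v : ~~ (c <= v) -> ~~ (x r <= v) by apply: contra; apply: le_trans; apply: leIl.
suff Bm : B <= m by case/negP: ncm; apply: le_trans Bm; apply: leIr.
apply/joinsP => i _; have [m' [m'M]] := sep i; rewrite leUx => /andP[bm' sm'] ncm'.
have sm : x s <= m by move: m0; rewrite leUx => /andP[].
by rewrite (meet_irreducible_step_unique _ _ _ x s r m m') ?cardM ?nr.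
Qed.
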